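(* Let $k$ be a subfield of $\mathbf{C}$, let $A$ be a locally finite graded set with an operation $[\cdot,\cdot]$ on $\bar A=A\cup\{0\}$ satisfying (S0)–(S3), and let $q\in k$. Then $(\mathfrak{A},*_q)$ is a graded (associative) $k$-algebra, which coincides with the quasi-shuffle algebra $(\mathfrak{A},* )$ when $q=1$.
   Context: $A$ is a graded set, $A=\bigsqcup_{n\ge1}A_n$ with each $A_n$ (the elements of degree $n$) finite; elements of $A$ are called letters and $|a|$ is the degree of a letter $a$. $\mathfrak{A}=k\langle A\rangle$ is the $k$-vector space of noncommutative polynomials in the letters, with basis the words (monomials) in the letters, including the empty word $1$. Juxtaposition denotes concatenation. The degree $|w|$ of a word $w$ is the sum of the degrees of its letters, and $\mathfrak{A}$ is graded by degree. Let $\bar A=A\cup\{0\}$ and let $[\cdot,\cdot]:\bar A\times\bar A\to\bar A$ be a function satisfying: (S0) $[a,0]=0$ for all $a\in\bar A$; (S1) $[a,b]=[b,a]$ for all $a,b\in\bar A$; (S2) $[[a,b],c]=[a,[b,c]]$ for all $a,b,c\in\bar A$; (S3) for all $a,b\in A$, either $[a,b]=0$ or $|[a,b]|=|a|+|b|$. The quasi-shuffle product $*$ is the $k$-bilinear operation on $\mathfrak{A}$ defined recursively on words by $1*w=w*1=w$ and $aw_1*bw_2=a(w_1*bw_2)+b(aw_1*w_2)+[a,b](w_1*w_2)$ for letters $a,b$ and words $w_1,w_2$. The product $*_q$ is the $k$-bilinear operation on $\mathfrak{A}$ defined recursively on words by $1*_qw=w*_q1=w$ and $aw_1*_qbw_2=a(w_1*_qbw_2)+q^{|aw_1||b|}\,b(aw_1*_qw_2)+q^{|w_1||b|}\,[a,b](w_1*_qw_2)$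 for letters $a,b$ and words $w_1,w_2$ (with $q^0=1$, also for $q=0$). *)

(* Defs.v *)
From mathcomp Require Import all_boot all_order all_algebra.
From mathcomp Require Import finmap monalg.
From mathcomp Require Import classical_sets cardinality.

Set Implicit Arguments.
Unset Strict Implicit.
Unset Printing Implicit Defensive.

Import GRing.Theory.
Local Open Scope ring_scope.

Definition locally_finite_graded_set (A : choiceType) (deg : A -> nat) : Prop :=
  (forall a : A, (0 < deg a)%N) /\
  (forall n : nat, finite_set [set a : A | deg a = n]%classic).

(* [option A] encodes the disjoint union of A and {0}, [None] being 0. *)
Record bracket_axioms (A : choiceType) (deg : A -> nat)
    (br : option A -> option A -> option A) : Prop := BracketAxioms {
  bracket_S0 : forall a, br a None = None;
  bracket_S1 : forall a b, br a b = br b a;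
  bracket_S2 : forall a b c, br (br a b) c = br a (br b c);
  bracket_S3 : forall a b : A, br (Some a) (Some b) = None \/
    exists2 c, br (Some a) (Some b) = Some c & deg c = (deg a + deg b)%N
}.

(* k<A> as the algebra of the free monoid on A: the library's ring product
   [_ * _] on this type is concatenation. *)
Notation ncpoly k A := {malg k[{fmonom A}]}.

Definition word (k : fieldType) (A : choiceType) (w : seq A) : ncpoly k A :=
  << FMonom w >>.

Definition letter (k : fieldType) (A : choiceType) (o : option A) : ncpoly k A :=
  if o is Some a then word k [:: a] else 0.

Definition wdeg (A : choiceType) (deg : A -> nat) (w : seq A) : nat :=
  (\sum_(a <- w) deg a)%N.

Definition homogeneous (k : fieldType) (A : choiceType) (deg : A -> nat)
    (n : nat) (x : ncpoly k A) : Prop :=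
  forall w : {fmonom A}, w \in msupp x -> wdeg deg w = n.

Definition bilinear_extension (k : fieldType) (A : choiceType)
    (f : seq A -> seq A -> ncpoly k A) (x y : ncpoly k A) : ncpoly k A :=
  \sum_(u <- msupp x) \sum_(v <- msupp y) (x@_u * y@_v) *: f u v.

Section Products.

Variables (k : fieldType) (A : choiceType) (deg : A -> nat).
Variable br : option A -> option A -> option A.

Local Notation "[[ a , b ]]" := (letter k (br (Some a) (Some b))).
Local Notation let1 a := (letter k (Some a)).

(* The inner fixpoint recurses on the second word, the first being [a :: u']. *)
Fixpoint qsh_word (u : seq A) : seq A -> ncpoly k A :=
  if u is a :: u' then
    fix qsh_u (v : seq A) : ncpoly k A :=
      if v is b :: v' then
        let1 a * qsh_word u' v + let1 b * qsh_u v' + [[a, b]] * qsh_word u' v'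
      else word k u
  else fun v => word k v.

Definition qsh : ncpoly k A -> ncpoly k A -> ncpoly k A :=
  bilinear_extension qsh_word.

Variable q : k.

Fixpoint qqsh_word (u : seq A) : seq A -> ncpoly k A :=
  if u is a :: u' then
    fix qqsh_u (v : seq A) : ncpoly k A :=
      if v is b :: v' then
        let1 a * qqsh_word u' v
        + q ^+ (wdeg deg u * deg b) *: (let1 b * qqsh_u v')
        + q ^+ (wdeg deg u' * deg b) *: ([[a, b]] * qqsh_word u' v')
      else word k u
  else fun v => word k v.

Definition qqsh : ncpoly k A -> ncpoly k A -> ncpoly k A :=
  bilinear_extension qqsh_word.

Lemma wordM (u v : seq A) : word k u * word k v = word k (u ++ v).
Proof. by rewrite malgM_def /word fgmulUU mulr1 [mmul _ _]fmmulE. Qed.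

Lemma bilinear_extension_word (f : seq A -> seq A -> ncpoly k A) (u v : seq A) :
  bilinear_extension f (word k u) (word k v) = f u v.
Proof.
rewrite /bilinear_extension /word !msuppU1 !big_seq_fset1.
by rewrite !mcoeffU1 !eqxx mulr1 scale1r.
Qed.

Lemma qsh1w v : qsh (word k [::]) (word k v) = word k v.
Proof. by rewrite /qsh bilinear_extension_word. Qed.

Lemma qshw1 u : qsh (word k u) (word k [::]) = word k u.
Proof. by rewrite /qsh bilinear_extension_word; case: u. Qed.

Lemma qsh_cons a b (u v : seq A) :
  qsh (word k (a :: u)) (word k (b :: v)) =
    let1 a * qsh (word k u) (word k (b :: v))
    + let1 b * qsh (word k (a :: u)) (word k v)
    + [[a, b]] * qsh (word k u) (word k v).
Proof. by rewrite /qsh !bilinear_extension_word. Qed.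

Lemma qqsh1w v : qqsh (word k [::]) (word k v) = word k v.
Proof. by rewrite /qqsh bilinear_extension_word. Qed.

Lemma qqshw1 u : qqsh (word k u) (word k [::]) = word k u.
Proof. by rewrite /qqsh bilinear_extension_word; case: u. Qed.

Lemma qqsh_cons a b (u v : seq A) :
  qqsh (word k (a :: u)) (word k (b :: v)) =
    let1 a * qqsh (word k u) (word k (b :: v))
    + q ^+ (wdeg deg (a :: u) * deg b)
        *: (let1 b * qqsh (word k (a :: u)) (word k v))
    + q ^+ (wdeg deg u * deg b) *: ([[a, b]] * qqsh (word k u) (word k v)).
Proof. by rewrite /qqsh !bilinear_extension_word. Qed.

End Products.

(* [V] with product [mul] and unit [one] is an associative unital [k]-algebra,
   graded by the subspaces [gr n]; [gr_span] and [gr_free] say that [V] is the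
   direct sum of the [gr n]. *)
Record graded_algebra (k : fieldType) (V : lmodType k)
    (gr : nat -> V -> Prop) (one : V) (mul : V -> V -> V) : Prop :=
  GradedAlgebra {
  gmul_linear_l : forall y, linear (fun x => mul x y);
  gmul_linear_r : forall x, linear (mul x);
  gmulA : associative mul;
  gmul1x : left_id one mul;
  gmulx1 : right_id one mul;
  gr0 : forall n, gr n 0;
  gr_linear : forall n (c : k) x y, gr n x -> gr n y -> gr n (c *: x + y);
  gr_span : forall x, exists N (c : nat -> V),
    (forall n, gr n (c n)) /\ x = \sum_(n < N) c n;
  gr_free : forall N (c : nat -> V), (forall n, gr n (c n)) ->
    \sum_(n < N) c n = 0 -> forall n, (n < N)%N -> c n = 0;
  gr_one : gr 0%N one;
  gr_mul : forall m n x y, gr m x -> gr n y -> gr (m + n)%N (mul x y)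
}.

(* Main.v *)
Require Import Defs.
From mathcomp Require Import all_boot all_order all_algebra.
From mathcomp Require Import finmap monalg reals complex ring.

(**
Associativity [U * (V * W) = (U * V) * W] on words [U = au], [V = bv], [W = cw]
is an induction on the three lengths. The recursive formula for a product of
words starting with letters extends to [a x] times [b y] for homogeneous [x],
since the exponents of [q] only involve degrees, and so it applies a second time
to each term of [V * W] and of [U * V]. On the left, the three terms starting
with [a] recombine into [a (u * (V * W))]; on the right, those starting with [c]
recombine into a multiple of [c ((U * V) * w)]. What remains are seven pairs of
terms, equal by the induction hypotheses, (S2) and the additivity of the degree
under the bracket (S3).
*)

Set Implicit Arguments.
Unset Strict Implicit.
Unset Printing Implicit Defensive.

Import GRing.Theory.
Local Open Scope ring_scope.

(** The maps used below are plain functions satisfying [linear], so the usual equations are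
    extracted from that predicate. *)
Lemma linear_eqs (k : pzRingType) (U V : lmodType k) (f : U -> V) :
  linear f ->
  [/\ f 0 = 0, forall x y, f (x + y) = f x + f y
    & forall c x, f (c *: x) = c *: f x].
Proof.
move=> fP; have fD x y : f (x + y) = f x + f y.
  by rewrite -[x]scale1r fP !scale1r.
have f0 : f 0 = 0 by apply: (addrI (f 0)); rewrite -fD !addr0.
by split=> // c x; rewrite -[c *: x]addr0 fP f0 addr0.
Qed.

(** * Linear arguments in a monoid algebra *)

Section MonoidAlgebra.

Variables (k : fieldType).

(** Restricting the basis case to the support lets one principle serve both arbitrary and
    homogeneous elements. *)
Lemma malg_ind_msupp (K : choiceType) (P : {malg k[K]} -> Prop)
    (x : {malg k[K]}) :
  P 0 -> (forall c y z, P y -> P z -> P (c *: y + z)) ->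
  (forall w, w \in msupp x -> P << w >>) -> P x.
Proof.
move=> P0 Plin Pw; rewrite (monalgE x) big_seq.
elim/big_rec: _ => // w y wx Py.
have -> : << x@_w *g w >> = x@_w *: << w >> :> {malg k[K]}.
  by apply/malgP => v; rewrite mcoeffZ !mcoeffU mulr_natr.
exact: Plin (Pw _ wx) Py.
Qed.

Lemma linear_extension_is_linear (K : choiceType) (V : lmodType k)
    (g : K -> V) :
  linear (fun x : {malg k[K]} => \sum_(u <- msupp x) x@_u *: g u).
Proof.
(* Supports vary with the element; over the common set [d] the added terms have coefficient 0 and
   the sums can be compared termwise. *)
move=> c x y; set d := (msupp x `|` msupp y `|` msupp (c *: x + y))%fset.
have E (z : {malg k[K]}) : (msupp z `<=` d)%fset ->
    \sum_(u <- msupp z) z@_u *: g u = \sum_(u <- d) z@_u *: g u.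
  move=> zd; apply: big_fset_incl => // u _ /mcoeff_outdom ->.
  by rewrite scale0r.
rewrite !E ?scaler_sumr -?big_split /=;
  try by apply/fsubsetP => u; rewrite !in_fsetU => ->; rewrite ?orbT.
by apply: eq_bigr => u _; rewrite mcoeffD mcoeffZ scalerDl scalerA.
Qed.

Lemma malg_scalerAr (K : monomType) (c : k) (x y : {malg k[K]}) :
  c *: (x * y) = x * (c *: y).
Proof.
apply/malgP => w; rewrite mcoeffZ mcoeffMl.
(* The support shrinks when [c = 0], so the product is expanded over [msupp y]. *)
rewrite (mcoeffMlw _ (fsubset_refl _) (msuppZ_le c y)) mulr_sumr.
apply: eq_bigr => u _; rewrite mulr_sumr; apply: eq_bigr => v _.
by rewrite mcoeffZ mulrnAr !mulrA [c * _]mulrC.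
Qed.

End MonoidAlgebra.

(** * Bilinearity of the extension from words *)

Section BilinearExtension.

Variables (k : fieldType) (A : choiceType).
Variable f : seq A -> seq A -> ncpoly k A.

Lemma bilinear_extension_linear_l (y : ncpoly k A) :
  linear (fun x => bilinear_extension f x y).
Proof.
have E x : bilinear_extension f x y =
    \sum_(u <- msupp x) x@_u *: \sum_(v <- msupp y) y@_v *: f u v.
  apply: eq_bigr => u _; rewrite scaler_sumr.
  by apply: eq_bigr => v _; rewrite scalerA.
by move=> c x z; rewrite !E (linear_extension_is_linear _ c x z).
Qed.

Lemma bilinear_extension_linear_r (x : ncpoly k A) :
  linear (bilinear_extension f x).
Proof.
have E y : bilinear_extension f x y =
    \sum_(v <- msupp y) y@_v *: \sum_(u <- msupp x) x@_u *: f u v.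
  rewrite /bilinear_extension exchange_big; apply: eq_bigr => v _.
  by rewrite scaler_sumr; apply: eq_bigr => u _; rewrite scalerA mulrC.
by move=> c y z; rewrite !E (linear_extension_is_linear _ c y z).
Qed.

End BilinearExtension.

(** * Degrees of letters and brackets, the letter 0 included *)

Section LetterDegree.

Variables (A : choiceType) (deg : A -> nat).

Lemma wdeg_cons a (w : seq A) : wdeg deg (a :: w) = (deg a + wdeg deg w)%N.
Proof. by rewrite /wdeg big_cons. Qed.

(* The letter 0 has every degree. *)
Definition letter_deg (o : option A) (d : nat) : Prop :=
  forall a, o = Some a -> deg a = d.

Lemma letter_deg_Some a : letter_deg (Some a) (deg a).
Proof. by move=> b [->]. Qed.

Variable br : option A -> option A -> option A.
Hypothesis br_ax : bracket_axioms deg br.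

Lemma brN0 o : br None o = None.
Proof. by rewrite (bracket_S1 br_ax) (bracket_S0 br_ax). Qed.

Lemma letter_deg_br o p d e :
  letter_deg o d -> letter_deg p e -> letter_deg (br o p) (d + e).
Proof.
case: o => [a|] od; last by rewrite brN0.
case: p => [b|] pe; last by rewrite (bracket_S0 br_ax).
rewrite -(od _ (erefl _)) -(pe _ (erefl _)).
by case: (bracket_S3 br_ax a b) => [->//|[c -> <-]]; exact: letter_deg_Some.
Qed.

End LetterDegree.

(* [V] plays the role of k<A>, with word basis [wd]; [lcons o] is concatenation
   with the letter [o] on the left and [gr n] the component of degree [n].
   Keeping [V] abstract spares the unifier the structures of [{malg k[_]}]. *)
Section QuantumQuasiShuffle.

Variables (k : comNzRingType) (V : lmodType k) (A : choiceType).
Variables (deg : A -> nat) (br : option A -> option A -> option A) (q : k).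
Variables (wd : seq A -> V) (lcons : option A -> V -> V) (qmul : V -> V -> V).
Variable gr : nat -> V -> Prop.

Hypothesis br_ax : bracket_axioms deg br.
Hypothesis lconsP : forall o, linear (lcons o).
Hypothesis lcons_None : forall x, lcons None x = 0.
Hypothesis wd_cons : forall a u, wd (a :: u) = lcons (Some a) (wd u).
Hypothesis wd_ind : forall P : V -> Prop,
  P 0 -> (forall c y z, P y -> P z -> P (c *: y + z)) ->
  (forall w, P (wd w)) -> forall x, P x.
Hypothesis gr_ind : forall n (P : V -> Prop),
  P 0 -> (forall c y z, P y -> P z -> P (c *: y + z)) ->
  (forall w, wdeg deg w = n -> P (wd w)) -> forall x, gr n x -> P x.
Hypothesis gr_0 : forall n, gr n 0.
Hypothesis grP : forall n c x y, gr n x -> gr n y -> gr n (c *: x + y).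
Hypothesis gr_wd : forall w, gr (wdeg deg w) (wd w).
Hypothesis qmulPl : forall z, linear (fun x => qmul x z).
Hypothesis qmulPr : forall z, linear (qmul z).
Hypothesis qmul1w : forall v, qmul (wd [::]) (wd v) = wd v.
Hypothesis qmulw1 : forall u, qmul (wd u) (wd [::]) = wd u.
Hypothesis qmul_cons : forall a b u v,
  qmul (wd (a :: u)) (wd (b :: v)) =
    lcons (Some a) (qmul (wd u) (wd (b :: v)))
    + q ^+ (wdeg deg (a :: u) * deg b)
        *: lcons (Some b) (qmul (wd (a :: u)) (wd v))
    + q ^+ (wdeg deg u * deg b)
        *: lcons (br (Some a) (Some b)) (qmul (wd u) (wd v)).

(** * Linearity and compatibility with the grading *)

Lemma lcons0 o : lcons o 0 = 0.
Proof. by case: (linear_eqs (lconsP o)). Qed.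
Lemma lconsD o x y : lcons o (x + y) = lcons o x + lcons o y.
Proof. by case: (linear_eqs (lconsP o)). Qed.
Lemma lconsZ o c x : lcons o (c *: x) = c *: lcons o x.
Proof. by case: (linear_eqs (lconsP o)). Qed.
Lemma qmul0l z : qmul 0 z = 0.
Proof. by case: (linear_eqs (qmulPl z)). Qed.
Lemma qmulDl x y z : qmul (x + y) z = qmul x z + qmul y z.
Proof. by case: (linear_eqs (qmulPl z)). Qed.
Lemma qmulZl c x z : qmul (c *: x) z = c *: qmul x z.
Proof. by case: (linear_eqs (qmulPl z)). Qed.
Lemma qmul0r z : qmul z 0 = 0.
Proof. by case: (linear_eqs (qmulPr z)). Qed.
Lemma qmulDr x y z : qmul z (x + y) = qmul z x + qmul z y.
Proof. by case: (linear_eqs (qmulPr z)). Qed.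
Lemma qmulZr c x z : qmul z (c *: x) = c *: qmul z x.
Proof. by case: (linear_eqs (qmulPr z)). Qed.

Lemma gr_D n x y : gr n x -> gr n y -> gr n (x + y).
Proof. by move=> hx hy; rewrite -[x]scale1r; exact: grP. Qed.

Lemma gr_Z n c x : gr n x -> gr n (c *: x).
Proof. by move=> hx; rewrite -[_ *: _]addr0; exact: grP. Qed.

Lemma gr_lcons o d n x : letter_deg deg o d -> gr n x -> gr (d + n) (lcons o x).
Proof.
case: o => [a|] od; last by rewrite lcons_None => _; exact: gr_0.
move: x; apply: gr_ind => [|c y z hy hz|w <-].
- by rewrite lcons0; exact: gr_0.
- by rewrite lconsP; exact: grP.
- by rewrite -wd_cons -(od a (erefl _)) -wdeg_cons; exact: gr_wd.
Qed.

(* [qmul_cons] extended from words to homogeneous elements [x] and to the letter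
   0, so that brackets can be handled as letters. *)
Lemma qmul_lcons o p d e n x y :
  letter_deg deg o d -> letter_deg deg p e -> gr n x ->
  qmul (lcons o x) (lcons p y) =
    lcons o (qmul x (lcons p y))
    + q ^+ ((d + n) * e) *: lcons p (qmul (lcons o x) y)
    + q ^+ (n * e) *: lcons (br o p) (qmul x y).
Proof.
case: o => [a|] od; last first.
  by rewrite (brN0 br_ax) !lcons_None !qmul0l lcons0 !scaler0 !addr0.
case: p => [b|] pe; last first.
  by rewrite (bracket_S0 br_ax) !lcons_None !qmul0r lcons0 !scaler0 !addr0.
rewrite -(od _ (erefl _)) -(pe _ (erefl _)) => hx; move: x hx y.
apply: gr_ind => [y|c x1 x2 E1 E2 y|u <-].
- by rewrite !(qmul0l, lcons0, scaler0, addr0).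
- rewrite !(lconsD, lconsZ, qmulDl, qmulZl) E1 E2 !scalerDr !scalerA.
  rewrite ![c * _]mulrC.
  by rewrite [LHS](AC (3*3) ((1*4)*(2*5)*(3*6))).
apply: wd_ind => [|c x1 x2 E1 E2|v].
- by rewrite !(qmul0r, lcons0, scaler0, addr0).
- rewrite !(lconsD, lconsZ, qmulDr, qmulZr) E1 E2 !scalerDr !scalerA.
  rewrite ![c * _]mulrC.
  by rewrite [LHS](AC (3*3) ((1*4)*(2*5)*(3*6))).
by rewrite -!wd_cons qmul_cons wdeg_cons.
Qed.

(** Induction along the recursion: each of its three terms has the total degree, the bracket term by
    (S3). *)
Lemma gr_qmul_wd u v : gr (wdeg deg u + wdeg deg v) (qmul (wd u) (wd v)).
Proof.
elim: u v => [|a u IHu] v; first by rewrite qmul1w /wdeg big_nil; exact: gr_wd.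
elim: v => [|b v IHv].
  by rewrite qmulw1 [wdeg _ [::]]big_nil addn0; exact: gr_wd.
have [da db] := (@letter_deg_Some _ deg a, @letter_deg_Some _ deg b).
rewrite qmul_cons; apply: gr_D; first apply: gr_D.
- by rewrite wdeg_cons -addnA; exact: gr_lcons.
- by rewrite [wdeg _ (b :: v)]wdeg_cons addnCA; apply/gr_Z/gr_lcons.
- rewrite !wdeg_cons addnACA; apply/gr_Z/gr_lcons => //.
  exact: (letter_deg_br br_ax).
Qed.

Lemma gr_qmul m n x y : gr m x -> gr n y -> gr (m + n) (qmul x y).
Proof.
move=> hx hy; move: x hx; apply: gr_ind => [|c x1 x2 h1 h2|u <-].
- by rewrite qmul0l; exact: gr_0.
- by rewrite qmulPl; exact: grP.
move: y hy; apply: gr_ind => [|c x1 x2 h1 h2|v <-].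
- by rewrite qmul0r; exact: gr_0.
- by rewrite qmulPr; exact: grP.
exact: gr_qmul_wd.
Qed.

(** * Unit and associativity *)

Lemma qmul1x x : qmul (wd [::]) x = x.
Proof.
apply: (wd_ind (P := fun x => qmul (wd [::]) x = x)) => // [|c y z Ey Ez].
  exact: qmul0r.
by rewrite qmulPr Ey Ez.
Qed.

Lemma qmulx1 x : qmul x (wd [::]) = x.
Proof.
apply: (wd_ind (P := fun x => qmul x (wd [::]) = x)) => // [|c y z Ey Ez].
  exact: qmul0l.
by rewrite qmulPl Ey Ez.
Qed.

Lemma qmul_wdA u v w :
  qmul (wd u) (qmul (wd v) (wd w)) = qmul (qmul (wd u) (wd v)) (wd w).
Proof.
elim: u v w => [|a u IHu] v w; first by rewrite !qmul1x.
elim: v w => [|b v IHv] w; first by rewrite qmul1x qmulx1.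
elim: w => [|c w IHw]; first by rewrite !qmulx1.
have da := @letter_deg_Some _ deg a.
have db := @letter_deg_Some _ deg b.
have dc := @letter_deg_Some _ deg c.
have dab := letter_deg_br br_ax da db; have dbc := letter_deg_br br_ax db dc.
(* Named instances allow unfolding [U] only on the left and [W] only on the right, and folding them
   back afterwards. *)
have EU := wd_cons a u; have EW := wd_cons c w.
have EUV := qmul_cons a b u v; have EVW := qmul_cons b c v w.
have aVW : lcons (Some a) (qmul (wd u) (qmul (wd (b :: v)) (wd (c :: w)))) =
    lcons (Some a) (qmul (wd u) (lcons (Some b) (qmul (wd v) (wd (c :: w)))))
    + q ^+ (wdeg deg (b :: v) * deg c) *:
        lcons (Some a)
          (qmul (wd u) (lcons (Some c) (qmul (wd (b :: v)) (wd w))))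
    + q ^+ (wdeg deg v * deg c) *:
        lcons (Some a)
          (qmul (wd u) (lcons (br (Some b) (Some c)) (qmul (wd v) (wd w)))).
  by rewrite EVW !(qmulDr, qmulZr, lconsD, lconsZ).
have cUV : lcons (Some c) (qmul (qmul (wd (a :: u)) (wd (b :: v))) (wd w)) =
    lcons (Some c) (qmul (lcons (Some a) (qmul (wd u) (wd (b :: v)))) (wd w))
    + q ^+ (wdeg deg (a :: u) * deg b) *:
        lcons (Some c)
          (qmul (lcons (Some b) (qmul (wd (a :: u)) (wd v))) (wd w))
    + q ^+ (wdeg deg u * deg b) *:
        lcons (Some c)
          (qmul (lcons (br (Some a) (Some b)) (qmul (wd u) (wd v))) (wd w)).
  by rewrite EUV !(qmulDl, qmulZl, lconsD, lconsZ).
rewrite EVW !(qmulDr, qmulZr) [in LHS]EU.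
rewrite (qmul_lcons _ da db (gr_wd u)) (qmul_lcons _ da dc (gr_wd u)).
rewrite (qmul_lcons _ da dbc (gr_wd u)) EUV !(qmulDl, qmulZl) [in RHS]EW.
rewrite (qmul_lcons _ da dc (gr_qmul_wd _ _)).
rewrite (qmul_lcons _ db dc (gr_qmul_wd _ _)).
rewrite (qmul_lcons _ dab dc (gr_qmul_wd _ _)) -EU -EW.
rewrite !scalerDr !scalerA -!exprD.
(* Terms 1, 4 and 7 are those starting with [a]; [aVW], read backwards, merges them. *)
rewrite [LHS](AC (3*3*3) ((1*4*7)*2*3*5*6*8*9)) /=.
rewrite -aVW !IHu !IHv IHw cUV (bracket_S2 br_ax) !scalerDr !scalerA -!exprD.
(* Terms 2, 5 and 8 start with [c]; they match the expansion by [cUV] of the left-hand term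
   [c ((U * V) * w)]. *)
rewrite [RHS](AC (3*3*3) (1*4*7*(2*5*8)*3*6*9)) /=.
(* Paired exponents of [q] are equal polynomials in the degrees of [a], [b], [c], [u], [v], [w]. *)
by rewrite !wdeg_cons; do !congr (_ + _) => //; congr (q ^+ _ *: _); ring.
Qed.

Lemma qmulA : associative qmul.
Proof.
move=> x y z; move: x; apply: wd_ind => [|c x1 x2 E1 E2|u].
- by rewrite !qmul0l.
- by rewrite !qmulPl E1 E2.
move: y; apply: wd_ind => [|c y1 y2 E1 E2|v].
- by rewrite qmul0l !qmul0r qmul0l.
- by rewrite !(qmulPl, qmulPr) E1 E2.
move: z; apply: wd_ind => [|c z1 z2 E1 E2|w].
- by rewrite !qmul0r.
- by rewrite !qmulPr E1 E2.
exact: qmul_wdA.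
Qed.

End QuantumQuasiShuffle.

(** * Direct sum decomposition by degree *)

Section Homogeneous.

Variables (k : fieldType) (A : choiceType) (deg : A -> nat).
Local Notation homog := (homogeneous (k := k) deg).

Lemma homogeneous0 n : homog n 0.
Proof. by move=> w; rewrite msupp0 in_fset0. Qed.

Lemma homogeneous_linear n (c : k) (x y : ncpoly k A) :
  homog n x -> homog n y -> homog n (c *: x + y).
Proof.
move=> hx hy w /(fsubsetP (msuppD_le _ _)); rewrite in_fsetU => /orP[|/hy//].
by move/(fsubsetP (msuppZ_le _ _))/hx.
Qed.

Lemma homogeneousD n (x y : ncpoly k A) :
  homog n x -> homog n y -> homog n (x + y).
Proof. by move=> hx hy; rewrite -[x]scale1r; apply: homogeneous_linear. Qed.

Lemma homogeneous_sum n (I : Type) (r : seq I) (P : pred I)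
    (F : I -> ncpoly k A) :
  (forall i, P i -> homog n (F i)) -> homog n (\sum_(i <- r | P i) F i).
Proof.
move=> hF; elim/big_ind: _ => //; first exact: homogeneous0.
by move=> x y; apply: homogeneousD.
Qed.

Lemma homogeneous_word (w : seq A) : homog (wdeg deg w) (word k w).
Proof. by move=> v; rewrite /word msuppU1 in_fset1 => /eqP->. Qed.

Lemma homogeneous_span (x : ncpoly k A) : exists N (c : nat -> ncpoly k A),
  (forall n, homog n (c n)) /\ x = \sum_(n < N) c n.
Proof.
(* The successor makes the bound strict, so every degree occurring in [x] indexes a component. *)
pose N := (\max_(w <- msupp x) wdeg deg w).+1.
have ltN (w : {fmonom A}) : w \in msupp x -> (wdeg deg w < N)%N.
  move=> wx.
  rewrite ltnS.
  by rewrite (@leq_bigmax_seq _ _ xpredT (fun w : {fmonom A} => wdeg deg w)).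
exists N.
exists (fun n => \sum_(w <- msupp x | wdeg deg w == n) << x@_w *g w >>).
split=> [n|].
  apply: homogeneous_sum => w /eqP <- v.
  by move/(fsubsetP msuppU_le); rewrite in_fset1 => /eqP->.
rewrite {1}[x]monalgE.
under [RHS]eq_bigr => n _ do rewrite big_mkcond.
rewrite exchange_big /= !big_seq; apply: eq_bigr => w wx.
rewrite (bigD1 (Ordinal (ltN w wx))) //= eqxx big1 ?addr0 // => n.
by rewrite -val_eqE /= eq_sym => /negPf->.
Qed.

Lemma homogeneous_free N (c : nat -> ncpoly k A) :
  (forall n, homog n (c n)) -> \sum_(n < N) c n = 0 ->
  forall n, (n < N)%N -> c n = 0.
Proof.
move=> hc c0 n nN; apply/malgP => w; rewrite mcoeff0.
have [/mcoeff_outdom//|/negbNE wc] := boolP (w \notin msupp (c n)).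
(* In the coefficient of [w] in the vanishing sum, only the component whose index is the degree of
   [w] contributes. *)
have := congr1 (mcoeff w) c0; rewrite raddf_sum mcoeff0 /= => <-.
rewrite (bigD1 (Ordinal nN)) //= big1 ?addr0 // => m mn.
apply: mcoeff_outdom; apply: contra mn => /hc wm.
by apply/eqP/val_inj; rewrite /= -(hc _ _ wc) wm.
Qed.

End Homogeneous.

(** * The abstract results applied to [qqsh], left concatenation being multiplication by
    [letter k o] *)

Section Qqsh.

Variables (k : fieldType) (A : choiceType) (deg : A -> nat).
Variables (br : option A -> option A -> option A) (q : k).
Hypothesis br_ax : bracket_axioms deg br.

Local Notation qqsh := (qqsh deg br q).
Local Notation homog := (homogeneous (k := k) deg).

Lemma qqsh_linear_l (y : ncpoly k A) : linear (fun x => qqsh x y).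
Proof. exact: bilinear_extension_linear_l. Qed.

Lemma qqsh_linear_r (x : ncpoly k A) : linear (qqsh x).
Proof. exact: bilinear_extension_linear_r. Qed.

Lemma ncpoly_ind (P : ncpoly k A -> Prop) :
  P 0 -> (forall c y z, P y -> P z -> P (c *: y + z)) ->
  (forall w, P (word k w)) -> forall x, P x.
Proof.
by move=> P0 Plin Pw x; apply: malg_ind_msupp => // -[w] _; exact: Pw.
Qed.

Lemma homogeneous_ind n (P : ncpoly k A -> Prop) :
  P 0 -> (forall c y z, P y -> P z -> P (c *: y + z)) ->
  (forall w, wdeg deg w = n -> P (word k w)) -> forall x, homog n x -> P x.
Proof.
by move=> P0 Plin Pw x hx; apply: malg_ind_msupp => // -[w] /hx; exact: Pw.
Qed.

Lemma letterM_linear o : linear (fun x : ncpoly k A => letter k o * x).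
Proof. by move=> c x y; rewrite mulrDr -malg_scalerAr. Qed.

Lemma letter_NoneM (x : ncpoly k A) : letter k None * x = 0.
Proof. exact: mul0r. Qed.

Lemma word_cons a (u : seq A) : word k (a :: u) = letter k (Some a) * word k u.
Proof. by rewrite wordM. Qed.

Lemma qqsh1x : left_id (word k [::]) qqsh.
Proof.
exact: (qmul1x ncpoly_ind qqsh_linear_r (qqsh1w deg br q)).
Qed.

Lemma qqshx1 : right_id (word k [::]) qqsh.
Proof.
exact: (qmulx1 ncpoly_ind qqsh_linear_l (qqshw1 deg br q)).
Qed.

Lemma qqshA : associative qqsh.
Proof.
exact: (qmulA br_ax letterM_linear letter_NoneM word_cons ncpoly_ind
  homogeneous_ind (@homogeneous0 k A deg) (@homogeneous_linear k A deg)
  (@homogeneous_word k A deg) qqsh_linear_l qqsh_linear_r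
  (qqsh1w deg br q) (qqshw1 deg br q) (qqsh_cons deg br q)).
Qed.

Lemma homogeneous_qqsh m n (x y : ncpoly k A) :
  homog m x -> homog n y -> homog (m + n) (qqsh x y).
Proof.
exact: (gr_qmul br_ax letterM_linear letter_NoneM word_cons
  homogeneous_ind (@homogeneous0 k A deg) (@homogeneous_linear k A deg)
  (@homogeneous_word k A deg) qqsh_linear_l qqsh_linear_r
  (qqsh1w deg br q) (qqshw1 deg br q) (qqsh_cons deg br q)).
Qed.

End Qqsh.

(** * The case [q = 1] and the conclusion *)

Lemma qqsh_word1 (k : fieldType) (A : choiceType) (deg : A -> nat)
    (br : option A -> option A -> option A) (u v : seq A) :
  qqsh_word deg br (1 : k) u v = qsh_word k br u v.
Proof.
elim: u v => [//|a u IHu]; elim=> [//|b v IHv].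
(* One step of the recursion with all powers of 1 removed, its recursive calls kept folded for the
   induction hypotheses. *)
transitivity (letter k (Some a) * qqsh_word deg br 1 u (b :: v)
    + letter k (Some b) * qqsh_word deg br 1 (a :: u) v
    + letter k (br (Some a) (Some b)) * qqsh_word deg br 1 u v).
  by rewrite /= !expr1n !scale1r.
by rewrite !IHu IHv.
Qed.

Theorem theorem5p1 (R : realType) (S : pred R[i]) (k : subFieldType S)
    (A : choiceType) (deg : A -> nat) (br : option A -> option A -> option A)
    (q : k) :
  locally_finite_graded_set deg ->
  bracket_axioms deg br ->
  graded_algebra (homogeneous (k := k) deg) (word k [::]) (qqsh deg br q) /\
  (q = 1 -> forall x y : ncpoly k A, qqsh deg br q x y = qsh br x y).
Proof.
move=> _ br_ax; split.
  split.
  - exact: qqsh_linear_l.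
  - exact: qqsh_linear_r.
  - exact: qqshA.
  - exact: qqsh1x.
  - exact: qqshx1.
  - exact: homogeneous0.
  - exact: homogeneous_linear.
  - exact: homogeneous_span.
  - exact: homogeneous_free.
  - have <- : wdeg deg [::] = 0%N by rewrite /wdeg big_nil.
    exact: homogeneous_word.
  - exact: homogeneous_qqsh.
move=> -> x y; apply: eq_bigr => u _; apply: eq_bigr => v _.
by rewrite qqsh_word1.
Qed.
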